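(* Let $G$ be a (finite, simple) graph with $mad(G)<3$. Then $ch_3^d(G)\le 8$.
   Context: For a graph $G$ and an integer $r\ge 1$, an $r$-dynamic coloring of $G$ is a proper vertex coloring $\phi$ such that for every vertex $v$, the neighborhood $N_G(v)$ contains at least $\min\{r,\deg_G(v)\}$ distinct colors. Given a list assignment $L$, $G$ is $r$-dynamically $L$-colorable if it has an $r$-dynamic coloring $\phi$ with $\phi(v)\in L(v)$ for all $v$. The list $r$-dynamic chromatic number $ch_r^d(G)$ is the least $k$ such that $G$ is $r$-dynamically $L$-colorable for every list assignment $L$ with $|L(v)|\ge k$ for all $v$. The maximum average degree $mad(G)$ is the maximum of $2|E(H)|/|V(H)|$ over all subgraphs $H$ of $G$ with at least one vertex. *)

(* Defs.v *)
From mathcomp Require Import all_boot all_order all_algebra.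
From mathcomp Require Import finmap boolp.

Set Implicit Arguments.
Unset Strict Implicit.
Unset Printing Implicit Defensive.

Import Order.TTheory GRing.Theory Num.Theory.

Record sgraph := SGraph {
  vertex :> finType;
  adj : rel vertex;
  adj_sym : symmetric adj;
  adj_irrefl : irreflexive adj }.

Section Graph.
Variable G : sgraph.

Definition nbh (v : G) : {set G} := [set u | adj v u].

Definition deg (v : G) : nat := #|nbh v|.

Definition edges : {set {set G}} :=
  [set [set x; y] | x in G, y in nbh x].

(* Subgraphs are not assumed induced: (A, F) has vertex set A and edge set F. *)
Definition is_subgraph (H : {set G} * {set {set G}}) : bool :=
  (H.2 \subset edges) && [forall e in H.2, e \subset H.1].

(* The default value 0 only matters for the graph without vertices: the ratios
   are all nonnegative. *)
Definition mad : rat :=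
  (\big[Num.max/0]_(H : {set G} * {set {set G}}
                      | is_subgraph H && (H.1 != set0))
     (2 * #|H.2|%:R / #|H.1|%:R))%R.

Section Coloring.
Variable C : choiceType.

Definition proper_coloring (phi : G -> C) : Prop :=
  forall u v : G, adj u v -> phi u <> phi v.

Definition dynamic_coloring (r : nat) (phi : G -> C) : Prop :=
  proper_coloring phi /\
  forall v : G, minn r (deg v) <= #|` [fset phi u | u in nbh v]%fset|.

Definition dynamically_list_colorable (r : nat) (L : G -> {fset C}) : Prop :=
  exists phi : G -> C,
    dynamic_coloring r phi /\ forall v : G, phi v \in L v.

End Coloring.

Definition dynamically_choosable (r k : nat) : Prop :=
  forall (C : choiceType) (L : G -> {fset C}),
    (forall v : G, k <= #|` L v|) -> dynamically_list_colorable r L.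

Lemma inj_dynamic_coloring (C : choiceType) (r : nat) (phi : G -> C) :
  injective phi -> dynamic_coloring r phi.
Proof.
move=> phi_inj; split=> [u v uv /phi_inj euv|v].
  by move: uv; rewrite euv adj_irrefl.
by rewrite card_imfset //= -cardE geq_minr.
Qed.

Lemma inj_list_choice (C : choiceType) (L : G -> {fset C}) (s : seq G) :
  (forall v, #|G| <= #|` L v|) -> uniq s ->
  exists phi : G -> C, {in s &, injective phi} /\ forall v, phi v \in L v.
Proof.
move=> cardL; elim: s => [_|x s IHs /= /andP[xNs s_uniq]].
  have nonempty v : exists c, c \in L v.
    have : 0 < #|` L v| by apply: leq_trans (cardL v); apply/card_gt0P; exists v.
    by rewrite cardfs_gt0 => /fset0Pn.
  by exists (fun v => xchoose (nonempty v)); split=> // v; exact: xchooseP.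
have [phi [phi_inj phiL]] := IHs s_uniq.
pose used := [fset d in map phi s]%fset.
have [c cLx cNused] : exists2 c, c \in L x & c \notin used.
  have : ~~ (L x `<=` used)%fset.
    apply/negP => /fsubset_leq_card; apply/negP; rewrite -ltnNge.
    apply: (leq_trans _ (cardL x)); apply: (@leq_ltn_trans (size s)).
      by rewrite card_fseq -(size_map phi); exact: size_undup.
    have xs_uniq : uniq (x :: s) by rewrite /= xNs.
    by have := card_uniqP xs_uniq => /= <-; exact: max_card.
  by case/fsubsetPn => c; exists c.
exists (fun v => if v == x then c else phi v); split=> [u v|v]; last first.
  by case: eqP => [->|].
have used_s w : w \in s -> c <> phi w.
  by move=> ws ecw; case/negP: cNused; rewrite ecw inE /= map_f.
rewrite !inE; case: eqP => [->|_]; case: eqP => [->|_] //=.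
- by move=> _ vs /used_s; case.
- by move=> us _ /esym/used_s; case.
- exact: phi_inj.
Qed.

Lemma ex_dynamically_choosable (r : nat) :
  exists k, `[< dynamically_choosable r k >].
Proof.
exists #|G|; apply/asboolP => C L cardL.
have [phi [phi_inj phiL]] := inj_list_choice cardL (enum_uniq G).
exists phi; split=> //; apply: inj_dynamic_coloring => u v.
by apply: phi_inj; rewrite mem_enum.
Qed.

(* asbool makes the choosability predicate boolean, as ex_minn requires. *)
Definition list_dynamic_chromatic_number (r : nat) : nat :=
  ex_minn (ex_dynamically_choosable r).

End Graph.

(* Main.v *)
Require Import Defs.
From mathcomp Require Import all_boot all_order all_algebra.
From mathcomp Require Import finmap boolp zify.

(** Let [A] be a set of vertices, and let degrees be taken in the subgraph that
    [A] induces. A partial colouring can be extended to an uncoloured vertex [u]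
    greedily: each neighbour [w] of [u] forbids its own colour and, as long as
    fewer than [r] colours occur around it, these colours too, so at most [r]
    colours in all. Hence [u] is reducible when the set [X] of its neighbours of
    degree at most 2 is nonempty and [r (d(u) - #|X|) + #|X| < k]: colour
    [A :\: X], uncolour [u], then colour [u] (each member of [X] now forbids at
    most one colour) and finally the members of [X] (at most [2 r < k] forbidden
    colours each). Vertices of degree at most 1 are reducible as well. For
    [r = 3] and [k = 8], if nothing is reducible then
    [#|X| + 6 <= 2 d(u) + 2 [d(u) <= 2]] for each [u]; summing over [u] and
    counting the edges at 2-vertices on both sides gives average degree at
    least 3. *)

Set Implicit Arguments.
Unset Strict Implicit.
Unset Printing Implicit Defensive.

Import Order.TTheory GRing.Theory Num.Theory.

Lemma exists_notin_fsets (I : finType) (C : choiceType) (B : {set I})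
    (F : I -> {fset C}) (K : {fset C}) :
  \sum_(i in B) #|` F i| < #|` K| ->
  exists2 c, c \in K & {in B, forall i, c \notin F i}.
Proof.
move=> lt_FK; pose U := (\bigcup_(i in B) F i)%fset.
have cardU : #|` U| <= \sum_(i in B) #|` F i|.
  rewrite /U; elim/big_rec2: _ => [|i n V _ leVn]; first by rewrite cardfs0.
  by rewrite (leq_trans (leq_card_fsetU _ _)) ?leq_add2l.
have : ~~ (K `<=` U)%fset.
  apply: contraL lt_FK => /fsubset_leq_card leKU.
  by rewrite -leqNgt (leq_trans leKU).
case/fsubsetPn => c cK cU; exists c => // i iB; apply: contra cU => cF.
by apply/bigfcupP; exists i; rewrite // mem_index_enum.
Qed.

Section InducedDegree.
Variable G : sgraph.
Implicit Types (A B S : {set G}) (u v w : G).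

Definition nbh_in A v : {set G} := nbh v :&: A.

Definition deg_in A v : nat := #|nbh_in A v|.

Lemma in_nbh_in A u v : (u \in nbh_in A v) = adj v u && (u \in A).
Proof. by rewrite !inE. Qed.

Lemma nbh_inU1 S u w :
  nbh_in (u |: S) w = if adj w u then u |: nbh_in S w else nbh_in S w.
Proof.
by apply/setP => x; case: ifP => wu; rewrite !inE; case: eqP => //= ->;
  rewrite wu.
Qed.

Lemma nbh_inD A B v : nbh_in A v :\: nbh_in B v = nbh_in (A :\: B) v.
Proof. by apply/setP => u; rewrite !inE; case: adj; rewrite ?andbF. Qed.

Lemma deg_inE A v : deg_in A v = \sum_(u in A) adj v u.
Proof.
rewrite /deg_in -sum1_card (eq_bigl _ _ (in_nbh_in A ^~ v)).
by rewrite -big_mkcondl; apply: eq_bigl => u; rewrite andbC.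
Qed.

Lemma leq_deg_in A B v : A \subset B -> deg_in A v <= deg_in B v.
Proof. by move=> sAB; rewrite subset_leq_card ?setIS. Qed.

Lemma deg_inU1 S u w :
  u \notin S -> deg_in (u |: S) w = adj w u + deg_in S w.
Proof. by move=> uS; rewrite !deg_inE big_setU1. Qed.

Lemma deg_inID A S v :
  S \subset A -> deg_in A v = deg_in S v + deg_in (A :\: S) v.
Proof. by move=> sSA; rewrite !deg_inE (big_setID S) /= (setIidPr sSA). Qed.

Lemma sum_deg_inC A B :
  \sum_(u in A) deg_in B u = \sum_(v in B) deg_in A v.
Proof.
under eq_bigr do rewrite deg_inE; rewrite exchange_big.
apply: eq_bigr => v _; rewrite deg_inE.
by apply: eq_bigr => u _; rewrite adj_sym.
Qed.

Definition induced_edges A : {set {set G}} := [set e in edges G | e \subset A].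

Lemma card_edge e : e \in edges G -> #|e| = 2.
Proof.
case/imset2P => x y _; rewrite inE => xy ->; rewrite cards2.
by case: eqP xy => // ->; rewrite adj_irrefl.
Qed.

Lemma induced_edges_at A v : v \in A ->
  [set e in induced_edges A | v \in e] = [set [set v; w] | w in nbh_in A v].
Proof.
move=> vA; apply/setP => e; rewrite !inE; apply/andP/imsetP.
  case=> /andP[/imset2P[x y _]]; rewrite inE => xy ->.
  rewrite subUset !sub1set => /andP[xA yA] /set2P[]->.
    by exists y; rewrite // in_nbh_in xy.
  by exists x; rewrite 1?setUC // in_nbh_in adj_sym xy.
case=> w; rewrite in_nbh_in => /andP[vw wA] ->.
rewrite set21 subUset !sub1set vA wA !andbT; split=> //.
by apply/imset2P; exists v w; rewrite ?inE.
Qed.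

Lemma card_induced_edges_at A v : v \in A ->
  #|[set e in induced_edges A | v \in e]| = deg_in A v.
Proof.
move=> vA; rewrite induced_edges_at // card_in_imset // => x y.
rewrite !in_nbh_in => /andP[vx _] _ /setP/(_ x).
rewrite set22 => /esym/set2P[xv|//].
by rewrite xv adj_irrefl in vx.
Qed.

Lemma handshake A : \sum_(v in A) deg_in A v = 2 * #|induced_edges A|.
Proof.
transitivity (\sum_(v in A) \sum_(e in induced_edges A | v \in e) 1).
  by apply: eq_bigr => v vA; rewrite -card_induced_edges_at // sum1dep_card.
rewrite (exchange_big_dep (mem (induced_edges A))) /= => [|v e _ /andP[]//].
rewrite mulnC -sum_nat_const; apply: eq_bigr => e eA.
have /setIdP[eE /subsetP sEA] := eA.
rewrite sum1dep_card -(card_edge eE); apply: eq_card => v.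
by rewrite inE eA /=; apply/andb_idl/sEA.
Qed.

Lemma sum_deg_in_le_mad A :
  ((\sum_(v in A) deg_in A v)%:R <= mad G * #|A|%:R)%R.
Proof.
have [->|A_neq0] := eqVneq A set0; first by rewrite big_set0 cards0 mulr0.
rewrite handshake natrM -ler_pdivrMr ?ltr0n ?card_gt0 //.
apply: (@le_bigmax_cond _ _ _ _ (A, induced_edges A) _
  (fun H : {set G} * {set {set G}} => 2 * #|H.2|%:R / #|H.1|%:R)%R).
rewrite A_neq0 andbT; apply/andP; split.
  by apply/subsetP => e; rewrite inE => /andP[].
by apply/forall_inP => e; rewrite inE => /andP[].
Qed.

Definition low_vertices A : {set G} := [set v in A | deg_in A v <= 2].

Lemma low_vertices_sub A : low_vertices A \subset A.
Proof. by apply/subsetP => v /setIdP[]. Qed.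

Definition reducible A u : bool :=
  (0 < deg_in (low_vertices A) u) &&
  (3 * deg_in (A :\: low_vertices A) u + deg_in (low_vertices A) u < 8).

(* Discharging: with initial charge [2 d(u) - 6], every vertex gives 1 to each
   neighbour of degree 2, which needs 2. *)
Lemma sparse_reducible A :
  \sum_(v in A) deg_in A v < 3 * #|A| ->
  exists2 u, u \in A & (deg_in A u <= 1) || reducible A u.
Proof.
move=> sparse; apply/exists_inP; apply: contraLR sparse.
rewrite negb_exists_in -leqNgt => /forall_inP irreducible.
pose low := low_vertices A.
have charge u : u \in A -> deg_in low u + 6 <= 2 * deg_in A u + 2 * (u \in low).
  move=> uA; have := irreducible u uA; rewrite /reducible inE uA.
  by have := deg_inID u (low_vertices_sub A); rewrite -/low; lia.
have low_count : \sum_(u in A) deg_in low u = \sum_(u in A) 2 * (u \in low).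
  rewrite sum_deg_inC [RHS](big_setID low) /=.
  rewrite (setIidPr (low_vertices_sub A)) [X in _ + X]big1 ?addn0; last first.
    by move=> v /setDP[_ /negPf->].
  apply: eq_bigr => v v_low; rewrite v_low.
  have /[!inE]/andP[vA dv] := v_low.
  by have := irreducible v vA; lia.
have : \sum_(u in A) (deg_in low u + 6) <=
       \sum_(u in A) (2 * deg_in A u + 2 * (u \in low)) by exact: leq_sum.
by rewrite 2!big_split /= low_count sum_nat_const -!big_distrr /=; lia.
Qed.

End InducedDegree.

Section PartialColoring.
Variables (G : sgraph) (C : choiceType) (L : G -> {fset C}) (r k : nat).
Implicit Types (A B S X : {set G}) (u v w : G) (phi : G -> C).

Definition colors phi B : {fset C} := [fset phi u | u in B]%fset.

Lemma card_colors_le phi B : #|` colors phi B| <= #|B|.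
Proof. by rewrite cardE; exact: leq_imfset_card. Qed.

Lemma card_colors_le1 phi B : #|B| <= 1 -> #|` colors phi B| = #|B|.
Proof.
move=> /card_le1_eqP eqB; rewrite card_in_imfset /= -?cardE // => u v uB vB _.
exact: eqB.
Qed.

Lemma colorsU phi A B :
  colors phi (A :|: B) = (colors phi A `|` colors phi B)%fset.
Proof.
apply/fsetP => c; rewrite inE; apply/imfsetP/orP => [[u /= /setUP[]]|].
- by move=> uA ->; left; apply/imfsetP; exists u.
- by move=> uB ->; right; apply/imfsetP; exists u.
- by case=> /imfsetP[u /= uAB ->]; exists u; rewrite // inE uAB ?orbT.
Qed.

Lemma colors1 phi u : colors phi [set u] = [fset phi u]%fset.
Proof.
apply/fsetP => c; rewrite inE; apply/imfsetP/eqP => [[v /= /set1P->]|->] //.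
by exists u; rewrite //= set11.
Qed.

Lemma colorsU1 phi u B : colors phi (u |: B) = (phi u |` colors phi B)%fset.
Proof. by rewrite colorsU colors1. Qed.

Definition proper_on S phi : Prop :=
  {in S &, forall u v, adj u v -> phi u <> phi v}.

(* Only the vertices of [S] are regarded as coloured: the colours still missing
   around [w] can come from its uncoloured neighbours in [A]. *)
Definition dynamic_on A S phi : Prop :=
  {in A, forall w, minn r (deg_in A w) <=
     #|` colors phi (nbh_in S w)| + deg_in (A :\: S) w}.

Definition partial_coloring A S phi : Prop :=
  [/\ forall v, phi v \in L v, proper_on S phi & dynamic_on A S phi].

Definition colorable_on A : Prop := exists phi, partial_coloring A A phi.

Lemma dynamic_on_uncolor A S S' phi :
  S' \subset S -> S \subset A -> dynamic_on A S phi -> dynamic_on A S' phi.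
Proof.
move=> sS'S sSA dyn w wA; apply: leq_trans (dyn w wA) _.
have colorsS : #|` colors phi (nbh_in S w)| <=
    #|` colors phi (nbh_in S' w)| + deg_in (S :\: S') w.
  have -> : nbh_in S w = nbh_in S' w :|: nbh_in (S :\: S') w.
    by rewrite -setIUr -{1}(setIidPr sS'S) setID.
  rewrite colorsU (leq_trans (leq_card_fsetU _ _)) //.
  by rewrite leq_add2l card_colors_le.
have := deg_inID w sSA; have := deg_inID w sS'S.
by have := deg_inID w (subset_trans sS'S sSA); lia.
Qed.

Lemma dynamic_on_widen A B S phi :
  S \subset A -> A \subset B -> {in B :\: A, forall w, deg_in S w <= 1} ->
  dynamic_on A S phi -> dynamic_on B S phi.
Proof.
move=> sSA sAB few dyn w wB; have degS := deg_inID w (subset_trans sSA sAB).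
have [wA|wA] := boolP (w \in A); last first.
  rewrite card_colors_le1 -/(deg_in S w) -?degS ?geq_minr //.
  by apply: few; rewrite inE wA.
have := dyn w wA; have := deg_inID w sAB.
by have := deg_inID w sSA; lia.
Qed.

Lemma partial_coloring_widen A B S :
  S \subset A -> A \subset B -> {in B :\: A, forall w, deg_in S w <= 1} ->
  colorable_on A -> exists phi, partial_coloring B S phi.
Proof.
move=> sSA sAB few [phi [phiL phi_proper phi_dyn]]; exists phi; split=> //.
  by move=> u v /(subsetP sSA) uA /(subsetP sSA); exact: phi_proper.
exact: dynamic_on_widen few (dynamic_on_uncolor sSA (subxx A) phi_dyn).
Qed.

Definition forbidden S phi w : {fset C} :=
  ((if w \in S then [fset phi w] else fset0) `|`
   (if #|` colors phi (nbh_in S w)| < r then colors phi (nbh_in S w)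
    else fset0))%fset.

Lemma card_forbidden S phi w :
  #|` forbidden S phi w| <= (w \in S) + minn r.-1 (deg_in S w).
Proof.
apply: (leq_trans (leq_card_fsetU _ _)); apply: leq_add.
  by case: (w \in S); rewrite ?cardfs1 ?cardfs0.
case: ifP => [lt_r|_]; last by rewrite cardfs0.
by rewrite leq_min card_colors_le andbT; lia.
Qed.

Lemma proper_on_extend S u c phi :
  u \notin S -> {in S, forall w, adj u w -> c \notin forbidden S phi w} ->
  proper_on S phi -> proper_on (u |: S) [eta phi with u |-> c].
Proof.
move=> uS c_ok phi_proper.
have c_neq w : w \in S -> adj u w -> c <> phi w.
  by move=> wS uw ecw; have := c_ok w wS uw; rewrite ecw !inE wS inE eqxx.
have old w : w \in S -> (w == u) = false.
  by move=> wS; apply: contraNF uS => /eqP<-.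
move=> x y /setU1P[->|xS] /setU1P[->|yS] /=; rewrite ?eqxx ?old //.
- by rewrite adj_irrefl.
- exact: c_neq.
- by rewrite adj_sym => uy; exact/nesym/c_neq.
- exact: phi_proper.
Qed.

Lemma dynamic_on_extend A S u c phi :
  S \subset A -> u \in A :\: S ->
  {in A, forall w, adj u w -> c \notin forbidden S phi w} ->
  dynamic_on A S phi -> dynamic_on A (u |: S) [eta phi with u |-> c].
Proof.
move=> sSA /setDP[uA uS] c_ok phi_dyn w wA; set psi := [eta _ with _ |-> _].
have sU1A : u |: S \subset A by rewrite subUset sub1set uA.
have uncolored : deg_in (A :\: S) w = adj w u + deg_in (A :\: (u |: S)) w.
  by have := deg_inID w sSA; rewrite (deg_inID w sU1A) deg_inU1 //; lia.
have colors_old : colors psi (nbh_in S w) = colors phi (nbh_in S w).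
  apply: eq_in_imfset => v /=; rewrite in_nbh_in => /andP[_ vS].
  by case: eqP vS uS => // -> ->.
have := phi_dyn w wA; rewrite uncolored nbh_inU1.
case: ifP => wu; last by rewrite colors_old.
rewrite colorsU1 /= eqxx colors_old cardfsU1.
have := c_ok w wA; rewrite adj_sym wu inE negb_or => /(_ isT)/andP[_].
by case: ifP => [_ ->|]; lia.
Qed.

Hypothesis card_L : forall v, k <= #|` L v|.

Lemma colorable_on0 : 0 < k -> colorable_on set0.
Proof.
move=> k_gt0; have L_neq0 v : exists c, c \in L v.
  by apply/fset0Pn; rewrite -cardfs_gt0 (leq_trans k_gt0).
exists (fun v => xchoose (L_neq0 v)); split=> [v|u v|w]; rewrite ?inE //.
exact: xchooseP.
Qed.

Lemma partial_coloring_extend A S u phi :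
  S \subset A -> u \in A :\: S -> partial_coloring A S phi ->
  \sum_(w in nbh_in A u) ((w \in S) + minn r.-1 (deg_in S w)) < k ->
  exists psi, partial_coloring A (u |: S) psi.
Proof.
move=> sSA uAS [phiL phi_proper phi_dyn] few.
have [|c cL c_ok] :=
    @exists_notin_fsets _ _ (nbh_in A u) (forbidden S phi) (L u).
  apply: leq_trans (card_L u); apply: leq_ltn_trans few.
  by apply: leq_sum => w _; exact: card_forbidden.
have {}c_ok : {in A, forall w, adj u w -> c \notin forbidden S phi w}.
  by move=> w wA uw; apply: c_ok; rewrite in_nbh_in uw.
exists [eta phi with u |-> c]; split.
- by move=> v /=; case: eqP => [->|].
- apply: proper_on_extend => //; first by case/setDP: uAS.
  by move=> w /(subsetP sSA); exact: c_ok.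
- exact: dynamic_on_extend.
Qed.

Hypothesis r_gt0 : 0 < r.

Lemma partial_coloring_complete A S phi :
  S \subset A -> partial_coloring A S phi ->
  {in A :\: S, forall v, r * deg_in A v < k} -> colorable_on A.
Proof.
have [n] := ubnP #|A :\: S|; elim: n S phi => // n IHn S phi.
rewrite ltnS => le_n sSA phi_col small.
have [/eqP|[v vAS]] := set_0Vmem (A :\: S).
  rewrite setD_eq0 => sAS; exists phi.
  have /eqP eAS : A == S by rewrite eqEsubset sAS.
  by rewrite {2}eAS.
have [|psi psi_col] := partial_coloring_extend sSA vAS phi_col.
  apply: leq_ltn_trans (small v vAS); rewrite mulnC -sum_nat_const.
  by apply: leq_sum => w _; lia.
have smaller : A :\: (v |: S) = (A :\: S) :\ v by rewrite setDDl setUC.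
apply: IHn psi_col _; rewrite ?smaller.
- by move: le_n; rewrite (cardsD1 v) vAS.
- by rewrite subUset sub1set (subsetP (subsetDl A S)).
- by move=> w /setD1P[_]; exact: small.
Qed.

Lemma colorable_on_leaf A v :
  r < k -> deg_in A v <= 1 -> colorable_on (A :\ v) -> colorable_on A.
Proof.
move=> lt_rk dv colD1.
have only_v w : w \in A :\: (A :\ v) -> w = v.
  by rewrite setDDr setDv set0U => /setIP[_ /set1P].
have few : {in A :\: (A :\ v), forall w, deg_in (A :\ v) w <= 1}.
  by move=> w /only_v->; apply: leq_trans dv; rewrite leq_deg_in ?subD1set.
have [phi phi_col] := partial_coloring_widen (subxx _) (subD1set A v) few colD1.
apply: partial_coloring_complete phi_col _; first exact: subD1set.
by move=> w /only_v->; nia.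
Qed.

Lemma colorable_on_low_nbh A u X :
  r * 2 < k -> u \in A -> X \subset nbh_in A u ->
  {in X, forall v, deg_in A v <= 2} ->
  r * #|nbh_in A u :\: X| + #|X| < k ->
  colorable_on (A :\: X) -> colorable_on A.
Proof.
move=> lt_rk uA sXN X_low few colD.
pose S := A :\: X :\ u.
have sSA : S \subset A by rewrite (subset_trans (subD1set _ _)) ?subsetDl.
have uAS : u \in A :\: S by rewrite !inE eqxx.
have sU1A : u |: S \subset A by rewrite subUset sub1set uA.
have degS : {in X, forall w, deg_in S w <= 1}.
  move=> w wX; have /(subsetP sXN) := wX; rewrite in_nbh_in adj_sym.
  case/andP=> wu _; have := leq_trans (leq_deg_in w sU1A) (X_low w wX).
  by rewrite deg_inU1 ?setD11 // wu.
have uncolored : {in A :\: (A :\: X), forall w, deg_in S w <= 1}.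
  by move=> w; rewrite setDDr setDv set0U => /setIP[_]; exact: degS.
have [phi phi_col] :=
  partial_coloring_widen (subD1set _ u) (subsetDl A X) uncolored colD.
have [|psi psi_col] := partial_coloring_extend sSA uAS phi_col.
  apply: leq_ltn_trans few; rewrite (big_setID X) /= (setIidPr sXN) addnC.
  rewrite mulnC -sum_nat_const -sum1_card leq_add //; apply: leq_sum => w wX.
    by lia.
  by rewrite !inE wX /= andbF (leq_trans (geq_minr _ _)) ?degS.
apply: partial_coloring_complete sU1A psi_col _ => v /setDP[vA].
rewrite !inE vA andbT negb_or => /andP[v_neq_u]; rewrite v_neq_u negbK => vX.
by apply: leq_ltn_trans lt_rk; rewrite leq_mul2l X_low ?orbT.
Qed.

End PartialColoring.

Section ThreeDynamic.
Variables (G : sgraph) (C : choiceType) (L : G -> {fset C}).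
Hypothesis card_L : forall v, 8 <= #|` L v|.
Implicit Types (A B : {set G}) (u : G).

Lemma colorable_on_reducible A u : u \in A -> reducible A u ->
  colorable_on L 3 (A :\: nbh_in (low_vertices A) u) -> colorable_on L 3 A.
Proof.
move=> uA /andP[_ few]; apply: (colorable_on_low_nbh card_L _ _ uA) => //.
- exact: setIS (low_vertices_sub A).
- by move=> v /setIP[_ /setIdP[]].
- by rewrite nbh_inD.
Qed.

Lemma sparse_colorable_on A :
  (forall B, B != set0 -> \sum_(v in B) deg_in B v < 3 * #|B|) ->
  colorable_on L 3 A.
Proof.
move=> sparse; have [n] := ubnP #|A|; elim: n A => // n IHn A.
rewrite ltnS => leAn.
have [->|A_neq0] := eqVneq A set0; first exact: (colorable_on0 _ card_L).
have [u uA /orP[leaf|red]] := sparse_reducible (sparse A A_neq0).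
  apply: (colorable_on_leaf card_L _ _ leaf) => //; apply: IHn.
  by rewrite (cardsD1 u) uA in leAn.
apply: (colorable_on_reducible uA red); apply: IHn; apply: leq_trans leAn.
have /andP[] := red; rewrite /deg_in => deg_gt0 _.
have sNA : nbh_in (low_vertices A) u \subset A.
  exact: subset_trans (subsetIr _ _) (low_vertices_sub A).
by have := subset_leq_card sNA; rewrite cardsDS //; lia.
Qed.

End ThreeDynamic.

Lemma list_dynamic_chromatic_number_le (G : sgraph) (r k : nat) :
  dynamically_choosable G r k -> list_dynamic_chromatic_number G r <= k.
Proof.
rewrite /list_dynamic_chromatic_number => choosable.
by case: ex_minnP => m _; apply; apply/asboolP.
Qed.

Lemma colorable_onT (G : sgraph) (C : choiceType) (L : G -> {fset C})
    (r : nat) :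
  colorable_on L r [set: G] -> dynamically_list_colorable r L.
Proof.
case=> phi [phiL phi_proper phi_dyn].
exists phi; split=> //; split=> [u v|v]; first exact: phi_proper.
have := phi_dyn v (in_setT v).
by rewrite setDT /deg_in /nbh_in setI0 cards0 addn0 setIT.
Qed.

Theorem theorem1p5 (G : sgraph) :
  (mad G < 3)%R -> list_dynamic_chromatic_number G 3 <= 8.
Proof.
move=> madG; apply: list_dynamic_chromatic_number_le => C L card_L.
apply/colorable_onT/(sparse_colorable_on card_L) => B B_neq0.
rewrite -(ltr_nat rat) natrM (le_lt_trans (sum_deg_in_le_mad B)) //.
by rewrite ltr_pM2r ?ltr0n ?card_gt0.
Qed.
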